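(* If two labeled graphs $G$ and $H$ define the same graph-link then the corresponding marked graphs $mark(G)$ and $mark(H)$ are equivalent under marked local complementation, $r$-simplification and marked-graph Reidemeister moves (that is, they are related by the equivalence relation generated by these operations).
   Context: Labeled graphs and graph-links. A labeled graph is a finite simple graph each of whose vertices is labeled by a pair $(a,\alpha)\in\{0,1\}\times\{+,-\}$. For a labeled (simple) graph, $G^v$ denotes the graph obtained by toggling the adjacency of every pair of distinct neighbors of $v$ (non-loop edges only). A graph-link is an equivalence class of labeled graphs under the equivalence relation generated by the following operations (and their inverses). $\Omega_g1$: adjoin or remove an isolated vertex with label $(0,\pm)$. $\Omega_g2$: adjoin or remove a pair of non-adjacent (resp. adjacent) vertices labeled $(0,\pm\alpha)$, i.e. one $(0,\alpha)$ and one $(0,-\alpha)$ (resp. $(1,\pm\alpha)$), that have the same adjacencies with other vertices. $\Omega_g3$: if $v,w,x$ are distinct vertices labeled $(0,-)$ such that the only neighbors of $x$ are $v$ and $w$, and $v,w$ are not adjacent, then change the labels of $v$ and $w$ to $(0,+)$, make $x$ adjacent to every vertex that is adjacent to precisely one of $v,w$, and remove the edges connecting $x$ to $v$ and $w$. $\Omega_g4$: if $v,w$ are adjacent vertices labeled $(0,\alpha)$ and $(0,\beta)$ respectively, replace $G$ with $((G^v)^w)^v$ and then change the labels of $v$ and $w$ to $(0,-\beta)$ and $(0,-\alpha)$ respectively. $\Omega_g4'$: if $v$ has label $(1,\alpha)$, replace $G$ with $G^v$, change the label of $v$ to $(1,-\alpha)$, and change the first coordinate of the label of each neighbor of $v$,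 leaving the second coordinate the same. Marked graphs. A marked graph is a finite undirected graph $G$ without multiple edges, in which each vertex may be looped or unlooped, each vertex is either unmarked or carries one of the marks $r,c,cr,u,ur$, together with a number $\phi\ge 0$ of free loops (extra components with no vertices or edges). Graphs are considered up to isomorphism. ''Adjacent'' and ''neighbor'' refer to distinct vertices; a vertex is isolated if it has no neighbors. $G-v-w$ is obtained by deleting the vertices $v,w$ and keeping everything else, including free loops. The marked graph $mark(G)$ of a labeled graph $G$ has the same vertices and non-loop edges, no free loops, and labels replaced as follows: $(0,+)$ becomes mark $u$ with a loop; $(0,-)$ becomes mark $u$ with no loop; $(1,+)$ becomes mark $c$ with no loop; $(1,-)$ becomes mark $c$ with a loop. $r$-simplification replaces $G$ by the marked graph obtained by removing the letter $r$ from the mark of every vertex whose mark includes $r$ and toggling the loop status of each such vertex. Marked local complement: for $v\in V(G)$, $G_{cru}^v$ is obtained from $G$ by making exactly these changes. (i) The mark of $v$ changes by unmarked $\leftrightarrow u$, $r\leftrightarrow ur$, $c\leftrightarrow cr$. (ii) The mark of each neighbor of $v$ changes by unmarked $\leftrightarrow r$, $c\leftrightarrow ur$, $u\leftrightarrow cr$. (iii) For any two distinct neighbors $x,y$ of $v$, the adjacency between $x$ and $y$ is toggled. Loops and free loops are not changed. For adjacent $v\ne w$ the marked pivot is $G_{cru}^{vw}=((G_{cru}^v)_{cru}^w)_{cru}^v$. Marked-graph Reidemeister moves. $\Omega.1$: adjoin or remove an isolated vertex (looped or unlooped) that is unmarked or marked $u$. $\Omega.2$: any of the following, or its inverse, where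 $v$ is a looped vertex and $w$ an unlooped vertex of $G$. (a) $v,w$ are both unmarked and have the same neighbors outside $\{v,w\}$: replace $G$ with $G-v-w$. (b) $v$ is marked $c$, $w$ is unmarked, $v$ is the only neighbor of $w$, and $z\notin\{v,w\}$ is a neighbor of $v$: replace $G$ with $G_{cru}^{vz}-v-w$. (c) $v$ is marked $c$, $w$ is unmarked, $v$ and $w$ have the same neighbors outside $\{v,w\}$, and $z\notin\{v,w\}$ is a neighbor of $v$ and $w$: replace $G$ with $G_{cru}^{vz}-v-w$. (d) $v$ is marked $c$, $w$ is unmarked, $v$ is the only neighbor of $w$, and $w$ is the only neighbor of $v$: replace $G$ with $G^+-v-w$, where $G^+$ is $G$ with one additional free loop. $\Omega.3$: suppose $u,v,w$ are three unmarked, pairwise adjacent vertices of $G$, $u$ is looped, $v$ and $w$ are unlooped, and every vertex $x\notin\{u,v,w\}$ is adjacent to either none or precisely two of $u,v,w$; replace $G$ with the graph obtained by removing the three edges $\{u,v\},\{u,w\},\{v,w\}$. The inverse of an $\Omega.3$ move, the composition of an $\Omega.3$ move with $\Omega.2$ moves, and the mirror image of an $\Omega.3$ move (toggle all loops, apply an $\Omega.3$ move, toggle all loops again) are also $\Omega.3$ moves. A marked-graph Reidemeister move consists of marked local complementations, followed by one $\Omega.1$, $\Omega.2$ or $\Omega.3$ move, followed by marked local complementations. *)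

(* Defs.v *)
From Stdlib Require Import Relations.
From mathcomp Require Import all_boot.

Set Implicit Arguments.
Unset Strict Implicit.
Unset Printing Implicit Defensive.

(* Loops play no role in adjacency, so they are kept apart from [adj] and
   recorded only in marked graphs. *)
Record sgraph := SGraph {
  vertex :> finType;
  adj : rel vertex;
  adj_sym : symmetric adj;
  adj_irr : irreflexive adj
}.

Section SimpleGraph.
Variable G : sgraph.
Implicit Types (u v w x y : G) (S : {set G}).

Definition isolated v : Prop := forall x, ~~ adj v x.

Definition only_neighbor v w : Prop := forall x, adj w x = (x == v).

Definition same_nbrs_outside v w : Prop :=
  forall x, x != v -> x != w -> adj v x = adj w x.

Definition lc_adj v : rel G :=
  fun x y => adj x y (+) [&& x != y, adj v x & adj v y].

Lemma lc_adj_sym v : symmetric (lc_adj v).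
Proof. by move=> x y; rewrite /lc_adj adj_sym eq_sym [adj v x && _]andbC. Qed.

Lemma lc_adj_irr v : irreflexive (lc_adj v).
Proof. by move=> x; rewrite /lc_adj adj_irr eqxx. Qed.

(* G^v; it has literally the same vertex type as G. *)
Definition local_compl v : sgraph := SGraph (lc_adj_sym v) (@lc_adj_irr v).

Definition del_adj S : rel {x : G | x \notin S} :=
  fun a b => adj (val a) (val b).

Lemma del_adj_sym S : symmetric (@del_adj S).
Proof. by move=> a b; apply: adj_sym. Qed.

Lemma del_adj_irr S : irreflexive (@del_adj S).
Proof. by move=> x; apply: adj_irr. Qed.

Definition sdel S : sgraph := SGraph (@del_adj_sym S) (@del_adj_irr S).

Definition remove_edges_adj S : rel G :=
  fun x y => adj x y && ~~ ((x \in S) && (y \in S)).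

Lemma remove_edges_adj_sym S : symmetric (remove_edges_adj S).
Proof. by move=> x y; rewrite /remove_edges_adj adj_sym andbC [in LHS]andbC
  [(y \in S) && _]andbC. Qed.

Lemma remove_edges_adj_irr S : irreflexive (remove_edges_adj S).
Proof. by move=> x; rewrite /remove_edges_adj adj_irr. Qed.

(* Removes every edge having both ends in S. *)
Definition remove_edges S : sgraph :=
  SGraph (remove_edges_adj_sym S) (@remove_edges_adj_irr S).

(* x is made adjacent to the y with [adj v y (+) adj w y].  When v and w are the
   neighbors of x and are not adjacent, this is false at y = v, w, x: the edges
   xv and xw disappear and all other edges at x are new. *)
Definition og3_adj v w x : rel G := fun a b =>
  [|| [&& a == x, b != x & adj v b (+) adj w b],
      [&& b == x, a != x & adj v a (+) adj w a] |
      [&& a != x, b != x & adj a b]].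

Lemma og3_adj_sym v w x : symmetric (og3_adj v w x).
Proof. by move=> a b; rewrite /og3_adj (adj_sym a b);
  case: (a == x); case: (b == x); rewrite ?orbF //= orbF. Qed.

Lemma og3_adj_irr v w x : irreflexive (og3_adj v w x).
Proof. by move=> a; rewrite /og3_adj adj_irr; case: (a == x). Qed.

Definition og3_graph v w x : sgraph :=
  SGraph (og3_adj_sym v w x) (@og3_adj_irr v w x).

End SimpleGraph.

Variant sign := Plus | Minus.

Definition opp_sign (s : sign) : sign :=
  match s with Plus => Minus | Minus => Plus end.

(* In a label (a, s), a = true stands for 1 and a = false for 0. *)
Definition label := (bool * sign)%type.

Record lgraph := LGraph {
  lgraph_sgraph :> sgraph;
  lab : lgraph_sgraph -> label
}.

Definition liso (G H : lgraph) : Prop :=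
  exists f : G -> H, [/\ bijective f,
    forall x y, adj (f x) (f y) = adj x y &
    forall x, lab (f x) = lab x].

Definition ldel (G : lgraph) (S : {set G}) : lgraph :=
  @LGraph (sdel S) (fun x => lab (val x)).

Definition og3 (G : lgraph) (v w x : G) : lgraph :=
  @LGraph (og3_graph v w x)
    [eta @lab G with v |-> (false, Plus), w |-> (false, Plus)].

Definition og4 (G : lgraph) (v w : G) (a b : sign) : lgraph :=
  @LGraph
    (@local_compl (@local_compl (@local_compl G v) w) v)
    [eta @lab G with v |-> (false, opp_sign b), w |-> (false, opp_sign a)].

Definition og4' (G : lgraph) (v : G) (a : sign) : lgraph :=
  @LGraph (local_compl v)
    (fun x => if x == v then (true, opp_sign a)
              else if adj v x then (~~ (lab x).1, (lab x).2)
              else lab x).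

(* One generator of the equivalence of labeled graphs.  Results are taken up to
   isomorphism; adjoining vertices is the inverse of removing them. *)
Variant lmove (G H : lgraph) : Prop :=
| Liso of liso G H
| Og1 (v : G) of
    isolated v & (lab v).1 = false & liso (ldel [set v]) H
| Og2_nonadj (v w : G) (a : sign) of
    v != w & ~~ adj v w &
    lab v = (false, a) & lab w = (false, opp_sign a) &
    same_nbrs_outside v w & liso (ldel [set v; w]) H
| Og2_adj (v w : G) (a : sign) of
    adj v w &
    lab v = (true, a) & lab w = (true, opp_sign a) &
    same_nbrs_outside v w & liso (ldel [set v; w]) H
| Og3 (v w x : G) of
    uniq [:: v; w; x] &
    lab v = (false, Minus) & lab w = (false, Minus) & lab x = (false, Minus) &
    (forall y, adj x y = (y == v) || (y == w)) & ~~ adj v w &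
    liso (og3 v w x) H
| Og4 (v w : G) (a b : sign) of
    adj v w & lab v = (false, a) & lab w = (false, b) & liso (og4 v w a b) H
| Og4' (v : G) (a : sign) of
    lab v = (true, a) & liso (og4' v a) H.

Definition same_graph_link : relation lgraph :=
  clos_refl_sym_trans lgraph lmove.

Variant vmark := Mnone | Mr | Mc | Mcr | Mu | Mur.

Record mgraph := MGraph {
  mgraph_sgraph :> sgraph;
  vmark_of : mgraph_sgraph -> vmark;
  looped : pred mgraph_sgraph;
  free_loops : nat
}.

Definition unmarked (G : mgraph) (v : G) : Prop := vmark_of v = Mnone.

Definition miso (G H : mgraph) : Prop :=
  free_loops G = free_loops H /\
  exists f : G -> H, [/\ bijective f,
    forall x y, adj (f x) (f y) = adj x y,
    forall x, vmark_of (f x) = vmark_of x &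
    forall x, looped (f x) = looped x].

Definition mdel (G : mgraph) (S : {set G}) : mgraph :=
  @MGraph (sdel S) (fun x => vmark_of (val x)) (fun x => looped (val x))
    (free_loops G).

Definition add_free_loop (G : mgraph) : mgraph :=
  @MGraph G (@vmark_of G) (@looped G) (free_loops G).+1.

Definition toggle_loops (G : mgraph) : mgraph :=
  @MGraph G (@vmark_of G) (fun x => ~~ looped x) (free_loops G).

Definition mark_of_label (l : label) : vmark := if l.1 then Mc else Mu.

Definition loop_of_label (l : label) : bool :=
  match l with
  | (false, Plus) | (true, Minus) => true
  | (false, Minus) | (true, Plus) => false
  end.

Definition mark (G : lgraph) : mgraph :=
  @MGraph G (fun x => mark_of_label (lab x)) (fun x => loop_of_label (lab x)) 0.

Definition has_r (m : vmark) : bool :=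
  match m with Mr | Mcr | Mur => true | Mnone | Mc | Mu => false end.

Definition drop_r (m : vmark) : vmark :=
  match m with
  | Mr => Mnone | Mcr => Mc | Mur => Mu
  | Mnone => Mnone | Mc => Mc | Mu => Mu
  end.

Definition r_simplify (G : mgraph) : mgraph :=
  @MGraph G (fun x => drop_r (vmark_of x))
    (fun x => looped x (+) has_r (vmark_of x)) (free_loops G).

Definition self_change (m : vmark) : vmark :=
  match m with
  | Mnone => Mu | Mu => Mnone
  | Mr => Mur | Mur => Mr
  | Mc => Mcr | Mcr => Mc
  end.

Definition nbr_change (m : vmark) : vmark :=
  match m with
  | Mnone => Mr | Mr => Mnone
  | Mc => Mur | Mur => Mc
  | Mu => Mcr | Mcr => Mu
  end.

Definition mlc (G : mgraph) (v : G) : mgraph :=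
  @MGraph (local_compl v)
    (fun x => if x == v then self_change (vmark_of x)
              else if adj v x then nbr_change (vmark_of x)
              else vmark_of x)
    (@looped G) (free_loops G).

Definition mpivot (G : mgraph) (v w : G) : mgraph :=
  @mlc (@mlc (@mlc G v) w) v.

Definition marked_lc (G H : mgraph) : Prop := exists v : G, miso (mlc v) H.

Definition omega1_remove (G H : mgraph) : Prop :=
  exists v : G, [/\ isolated v, unmarked v \/ vmark_of v = Mu &
                    miso (mdel [set v]) H].

(* In (a) and (c), v and w may or may not be adjacent. *)
Variant omega2_reduce (G H : mgraph) : Prop :=
| Omega2a (v w : G) of
    looped v & ~~ looped w & unmarked v & unmarked w &
    same_nbrs_outside v w &
    miso (mdel [set v; w]) H
| Omega2b (v w z : G) of
    looped v & ~~ looped w & vmark_of v = Mc & unmarked w &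
    only_neighbor v w & z != v & z != w & adj v z &
    miso (@mdel (mpivot v z) [set v; w]) H
| Omega2c (v w z : G) of
    looped v & ~~ looped w & vmark_of v = Mc & unmarked w &
    same_nbrs_outside v w & z != v & z != w & adj v z & adj w z &
    miso (@mdel (mpivot v z) [set v; w]) H
| Omega2d (v w : G) of
    looped v & ~~ looped w & vmark_of v = Mc & unmarked w &
    only_neighbor v w & only_neighbor w v &
    miso (@mdel (add_free_loop G) [set v; w]) H.

Definition omega1 (G H : mgraph) : Prop :=
  omega1_remove G H \/ omega1_remove H G.

Definition omega2 (G H : mgraph) : Prop :=
  omega2_reduce G H \/ omega2_reduce H G.

Definition remove_triangle (G : mgraph) (u v w : G) : mgraph :=
  @MGraph (remove_edges [set u; v; w]) (@vmark_of G) (@looped G) (free_loops G).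

Definition omega3_basic (G H : mgraph) : Prop :=
  exists u v w : G,
    [/\ [/\ unmarked u, unmarked v & unmarked w],
        [/\ adj u v, adj u w & adj v w],
        [/\ looped u, ~~ looped v & ~~ looped w],
        forall x, x \notin [set u; v; w] ->
          adj x u + adj x v + adj x w \in [:: 0; 2] &
        miso (remove_triangle u v w) H].

Inductive omega3 : relation mgraph :=
| Omega3_basic G H of omega3_basic G H : omega3 G H
| Omega3_inv G H of omega3 G H : omega3 H G
| Omega3_omega2 G K H of omega3 G K & omega2 K H : omega3 G H
| Omega2_omega3 G K H of omega2 G K & omega3 K H : omega3 G H
| Omega3_mirror G H of omega3 (toggle_loops G) (toggle_loops H) : omega3 G H.

Definition marked_lcs : relation mgraph := clos_refl_trans mgraph marked_lc.

Definition reidemeister_move (G H : mgraph) : Prop :=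
  exists G' H', [/\ marked_lcs G G',
                    [\/ omega1 G' H', omega2 G' H' | omega3 G' H'] &
                    marked_lcs H' H].

Variant mmove (G H : mgraph) : Prop :=
| Miso of miso G H
| Mlc of marked_lc G H
| Mrsimp of miso (r_simplify G) H
| Mreidemeister of reidemeister_move G H.

Definition marked_equiv : relation mgraph := clos_refl_sym_trans mgraph mmove.

(* Main.v *)
Require Import Defs.
From Stdlib Require Import Relations.
From mathcomp Require Import all_boot.

Set Implicit Arguments.
Unset Strict Implicit.
Unset Printing Implicit Defensive.

(** Work modulo r-simplification.  The move Og4' is then a local complement, the
    two Og2 moves become Omega.2(a) once [v] and [w] are unmarked by local
    complements at [v] and [w] (resp. by a pivot on [vw]), and Og3 is a mirrored
    Omega.3 move, conjugated by the pivot on [vw] of the local complement at [x].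
    A pivot realises Og4 only when [v] and [w] carry equal signs: each vertex
    keeps its own sign, negated, while the two neighborhoods are exchanged.  To
    exchange the signs we toggle both loops, which is possible because loops at
    non-isolated vertices marked [u] or [c] are immaterial.  Indeed, if [v] is
    looped with mark [c] and has a neighbor [z], give [v] two unmarked twins [w]
    and [w'] (looped) by Omega.2(a); then Omega.2(c), for the non-adjacent pair
    [v], [w], pivots on [vz] and deletes [v] and [w]; this isolates [w'], which
    Omega.1 removes.  So [G] is equivalent to [G^{vz} - v], and toggling the loop
    at [v] changes this graph only by a local complement at [z]. *)

Lemma inj_surj_bij (A B : finType) (f : A -> B) :
  injective f -> (forall y, exists x, f x = y) -> bijective f.
Proof.
move=> f_inj f_surj; have ex y : exists x, f x == y.
  by have [x <-] := f_surj y; exists x.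
exists (fun y => xchoose (ex y)) => x; last exact/eqP/(xchooseP (ex x)).
exact/f_inj/eqP/(xchooseP (ex (f x))).
Qed.

(** * Pivots of simple and marked graphs *)

Definition pivot (G : sgraph) (v w : G) : sgraph :=
  @local_compl (@local_compl (@local_compl G v) w) v.

Section Pivot.
Variables (G : sgraph) (v w : G).
Hypothesis vw : adj v w.

Let wv : adj w v. Proof. by rewrite adj_sym. Qed.
Let v_w : (v == w) = false.
Proof. by apply: contraTF vw => /eqP->; rewrite adj_irr. Qed.
Let w_v : (w == v) = false. Proof. by rewrite eq_sym. Qed.

Ltac pivot_simp :=
  rewrite /= /lc_adj /= /lc_adj /= /lc_adj ?adj_irr ?vw ?wv ?v_w ?w_v ?eqxx /=.

Lemma pivot_adj_l y : y != v -> y != w -> adj (v : pivot v w) y = adj w y.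
Proof.
move=> /negPf yv /negPf yw; pivot_simp.
rewrite ![_ == y]eq_sym yv yw /=.
by case: (adj v y); case: (adj w y).
Qed.

Lemma pivot_adj_r y : y != v -> y != w -> adj (w : pivot v w) y = adj v y.
Proof.
move=> /negPf yv /negPf yw; pivot_simp.
rewrite ![_ == y]eq_sym yv yw /=.
by case: (adj v y); case: (adj w y).
Qed.

Lemma pivot_adj_lr : adj (v : pivot v w) w.
Proof. by pivot_simp. Qed.

(** The correction term is a 2 by 2 determinant over the field with two elements. It is nonzero
    exactly when [x] and [y] both have neighbors in [{v, w}] and these two sets of neighbors
    differ. *)
Lemma pivot_adj_out x y : x != v -> x != w -> y != v -> y != w ->
  adj (x : pivot v w) y
  = adj x y (+) ((adj v x && adj w y) (+) (adj w x && adj v y)).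
Proof.
move=> /negPf xv /negPf xw /negPf yv /negPf yw; pivot_simp.
rewrite ![_ == y]eq_sym ![v == x]eq_sym ![w == x]eq_sym yv yw xv xw.
case: (eqVneq y x) => [->|_] /=.
  by rewrite adj_irr; case: (adj v x); case: (adj w x).
by case: (adj x y); case: (adj v x); case: (adj w x); case: (adj v y);
  case: (adj w y).
Qed.

End Pivot.

Lemma nbr_changeK : involutive nbr_change. Proof. by case. Qed.
(** The two involutions swap the ends of alternate edges of the hexagon unmarked, [u], [cr], [c],
    [ur], [r]. Their product moves two steps along it, hence has order 3. *)
Lemma change_braid m :
  self_change (nbr_change (self_change m))
  = nbr_change (self_change (nbr_change m)).
Proof. by case: m. Qed.

Section MarkedPivot.
Variables (G : mgraph) (v w : G).
Hypothesis vw : adj v w.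

Let wv : adj w v. Proof. by rewrite adj_sym. Qed.
Let v_w : (v == w) = false.
Proof. by apply: contraTF vw => /eqP->; rewrite adj_irr. Qed.
Let w_v : (w == v) = false. Proof. by rewrite eq_sym. Qed.

(** The marks of [v] and [w] undergo the two sides of the braid relation. Any other vertex is a
    neighbor of the current center an even number of times, so its changes cancel. *)
Lemma mpivot_mark (x : G) : @vmark_of (mpivot v w) x =
  if (x == v) || (x == w)
  then nbr_change (self_change (nbr_change (vmark_of x)))
  else vmark_of x.
Proof.
rewrite /mpivot /= /lc_adj /= /lc_adj !adj_irr vw ?wv ?v_w ?w_v ?eqxx /=.
case: (eqVneq x v) => [->|xv] /=.
  by rewrite v_w w_v wv adj_irr -change_braid.
case: (eqVneq x w) => [->|xw] /=; first by rewrite vw adj_irr.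
by case: (adj v x); case: (adj w x); rewrite /= ?nbr_changeK.
Qed.

End MarkedPivot.

(** * The generators as equivalences *)

Lemma marked_equiv_trans G H K :
  marked_equiv G H -> marked_equiv H K -> marked_equiv G K.
Proof. exact: rst_trans. Qed.

Lemma marked_equiv_sym G H : marked_equiv G H -> marked_equiv H G.
Proof. exact: rst_sym. Qed.

Lemma miso_refl G : miso G G.
Proof. by split=> //; exists id; split=> //; exists id. Qed.

Lemma miso_equiv G H : miso G H -> marked_equiv G H.
Proof. by move=> GH; apply: rst_step; apply: Miso. Qed.

Lemma mlc_equiv (G : mgraph) (v : G) : marked_equiv G (mlc v).
Proof. by apply: rst_step; apply: Mlc; exists v; apply: miso_refl. Qed.

Lemma r_simplify_equiv (G : mgraph) : marked_equiv G (r_simplify G).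
Proof. by apply: rst_step; apply: Mrsimp; apply: miso_refl. Qed.

Lemma mpivot_equiv (G : mgraph) (v w : G) : marked_equiv G (mpivot v w).
Proof.
apply: marked_equiv_trans (mlc_equiv v) _.
exact: marked_equiv_trans (@mlc_equiv (mlc v) w)
  (@mlc_equiv (mlc (G := mlc v) w) v).
Qed.

Lemma omega_equiv G H :
  [\/ omega1 G H, omega2 G H | omega3 G H] -> marked_equiv G H.
Proof.
move=> GH; apply: rst_step; apply: Mreidemeister; exists G, H.
by split=> //; apply: rt_refl.
Qed.

Lemma omega1_equiv (G : mgraph) (v : G) :
  isolated v -> unmarked v \/ vmark_of v = Mu -> marked_equiv G (mdel [set v]).
Proof.
move=> iso_v mark_v; apply/omega_equiv/Or31; left.
by exists v; split=> //; apply: miso_refl.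
Qed.

Lemma omega2_equiv G H : omega2_reduce G H -> marked_equiv G H.
Proof. by move=> GH; apply/omega_equiv/Or32; left. Qed.

Lemma omega2a_equiv (G : mgraph) (v w : G) :
  looped w = ~~ looped v -> unmarked v -> unmarked w -> same_nbrs_outside v w ->
  marked_equiv G (mdel [set v; w]).
Proof.
move=> loop_w un_v un_w vw; apply: omega2_equiv.
case loop_v : (looped v); rewrite loop_v /= in loop_w.
  by apply: (@Omega2a _ _ v w); rewrite ?loop_v ?loop_w //; apply: miso_refl.
rewrite setUC; apply: (@Omega2a _ _ w v); rewrite ?loop_v ?loop_w //.
  by move=> x xw xv; rewrite vw.
exact: miso_refl.
Qed.

(** The hypotheses make [f] an isomorphism between the r-simplifications of [G] and [H], and each
    graph is equivalent to its own simplification. *)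
Lemma equiv_mod_r (G H : mgraph) (f : G -> H) :
  free_loops G = free_loops H -> bijective f ->
  (forall x y, adj (f x) (f y) = adj x y) ->
  (forall x, drop_r (vmark_of (f x)) = drop_r (vmark_of x)) ->
  (forall x, looped (f x) (+) has_r (vmark_of (f x))
             = looped x (+) has_r (vmark_of x)) ->
  marked_equiv G H.
Proof.
move=> fl bij_f adj_f mark_f loop_f.
apply: marked_equiv_trans (r_simplify_equiv G) _.
apply: marked_equiv_trans _ (marked_equiv_sym (r_simplify_equiv H)).
by apply: miso_equiv; split=> //; exists f.
Qed.

(** Components that agree only pointwise give isomorphic graphs rather than equal ones. *)
Lemma id_equiv (V : finType) (a b : rel V) sa ia sb ib m1 m2 l1 l2 n :
  a =2 b -> m1 =1 m2 -> l1 =1 l2 ->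
  marked_equiv (@MGraph (@SGraph V a sa ia) m1 l1 n)
               (@MGraph (@SGraph V b sb ib) m2 l2 n).
Proof.
move=> ab m12 l12; apply: miso_equiv; split=> //; exists id.
by split=> //; exists id.
Qed.

(** * Isomorphisms of graphs with deleted vertices *)

(** The map [f] may miss vertices of [T]. This allows a graph to be compared, through [inl], with
    its extension by twins. *)
Lemma miso_mdel (G H : mgraph) (S : {set G}) (T : {set H}) (f : G -> H) :
  free_loops G = free_loops H ->
  injective f -> (forall x, (f x \in T) = (x \in S)) ->
  (forall y, y \notin T -> exists x, f x = y) ->
  (forall x y, x \notin S -> y \notin S -> adj (f x) (f y) = adj x y) ->
  (forall x, x \notin S -> vmark_of (f x) = vmark_of x) ->
  (forall x, x \notin S -> looped (f x) = looped x) ->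
  miso (mdel S) (mdel T).
Proof.
move=> fl f_inj fT f_surj adj_f mark_f loop_f; split=> //.
have fP (u : {x | x \notin S}) : f (val u) \notin T by rewrite fT (valP u).
exists (fun u => exist (fun y => y \notin T) (f (val u)) (fP u)); split.
- apply: inj_surj_bij => [u u' /(congr1 val) uu' | [y yT]].
    exact/val_inj/f_inj.
  have [x fx] := f_surj y yT.
  have xS : x \notin S by rewrite -fT fx.
  by exists (exist _ x xS); apply: (@val_inj _ (fun y => y \notin T)).
- by move=> u u'; apply: adj_f; [apply: (valP u) | apply: (valP u')].
- by move=> u; apply: mark_f; apply: (valP u).
- by move=> u; apply: loop_f; apply: (valP u).
Qed.

Lemma miso_mdel_mdel (G : mgraph) (S : {set G}) (u : mdel S) :
  miso (mdel (G := mdel S) [set u]) (mdel (val u |: S)).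
Proof.
split=> //.
have fP (p : {y : mdel S | y \notin [set u]}) : val (val p) \notin val u |: S.
  rewrite !inE negb_or (valP (val p)) andbT (inj_eq val_inj).
  by have := valP p; rewrite inE.
exists (fun p => exist (fun y => y \notin val u |: S) (val (val p)) (fP p)).
split=> //; apply: inj_surj_bij.
  by move=> p q /(congr1 val) pq; apply/val_inj/val_inj.
move=> [y yS]; have := yS; rewrite !inE negb_or => /andP[yu yS'].
have pP : exist (fun y => y \notin S) y yS' \notin [set u].
  by rewrite inE -(inj_eq val_inj).
exists (exist (fun y : mdel S => y \notin [set u]) _ pP).
by apply: (@val_inj _ (fun y => y \notin val u |: S)).
Qed.

Lemma mlc_mdel (G : mgraph) (S : {set G}) (u : mdel S) :
  marked_equiv (mdel S) (mdel (G := mlc (val u)) S).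
Proof.
apply: marked_equiv_trans (mlc_equiv u) _.
by apply: id_equiv => // x y.
Qed.


Lemma mdel_set0 (G : mgraph) : miso (mdel (set0 : {set G})) G.
Proof.
split=> //; exists val; split=> //; apply: inj_surj_bij; first exact: val_inj.
move=> x; have x0 : x \notin (set0 : {set G}) by rewrite inE.
by exists (exist _ x x0).
Qed.

(** * Deleting a looped vertex marked [c] by means of twins *)

Section Twins.
Variables (G : mgraph) (v : G).

(* [inr true] is the looped twin of [v] and [inr false] the unlooped one; they
   are adjacent neither to [v] nor to each other. *)
Definition untwin (u : G + bool) : G := if u is inl x then x else v.

Definition twin_adj : rel (G + bool) := fun x y => adj (untwin x) (untwin y).

Lemma twin_adj_sym : symmetric twin_adj.
Proof. by move=> x y; apply: adj_sym. Qed.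

Lemma twin_adj_irr : irreflexive twin_adj.
Proof. by move=> x; apply: adj_irr. Qed.

Definition twins : mgraph := @MGraph
  (@SGraph (G + bool)%type twin_adj twin_adj_sym twin_adj_irr)
  (fun u => if u is inl x then vmark_of x else Mnone)
  (fun u => match u with inl x => looped x | inr b => b end)
  (free_loops G).

(** The two twins have opposite loops and the same neighbors, so a single Omega.2(a) move removes
    both. *)
Lemma twins_equiv : marked_equiv G twins.
Proof.
apply: marked_equiv_sym.
have := @omega2a_equiv twins (inr true) (inr false).
move=> /(_ erefl erefl erefl (fun _ _ _ => erefl)) /marked_equiv_trans; apply.
apply: marked_equiv_trans (miso_equiv (mdel_set0 G)).
apply/marked_equiv_sym/miso_equiv.
apply: (@miso_mdel G twins _ _ inl) => //.
- by move=> x y [].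
- by move=> x; rewrite !inE.
- by case=> [x|[]]; rewrite !inE //; exists x.
Qed.

Lemma delete_c z : vmark_of v = Mc -> looped v -> adj v z ->
  marked_equiv G (@mdel (mpivot v z) [set v]).
Proof.
move=> mark_v loop_v vz; apply: marked_equiv_trans twins_equiv _.
have zv : z != v by apply: contraTneq vz => ->; rewrite adj_irr.
pose P : mgraph := @mpivot twins (inl v) (inl z).
apply: (@marked_equiv_trans _ (@mdel P [set inl v; inr false])).
  apply: omega2_equiv.
  apply: (@Omega2c twins _ (inl v) (inr false) (inl z)) => //.
  exact: miso_refl.
have tP : (inr true : P) \notin [set inl v; inr false] by rewrite !inE.
pose t : @mdel P [set inl v; inr false] := exist _ (inr true) tP.
apply: (@marked_equiv_trans _ (mdel [set t])).
  apply: omega1_equiv; last first.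
    left; rewrite /unmarked /=.
    exact: (@mpivot_mark twins (inl v) (inl z) vz (inr true)).
  (* The looped twin is adjacent to [z] but not to [v]. Off [z] its old adjacency [adj v y] is
     cancelled by an equal correction; at [z] the pivot gives it its old adjacency to [v], which is
     false. *)
  move=> [y yS] /=; apply/negP => ty.
  have {}ty : adj (inr true : pivot (G := twins) (inl v) (inl z)) y by [].
  case: y yS ty => [y|[]]; rewrite !inE ?orbT // => yS.
    have /norP[yv _] := yS.
    case: (eqVneq y z) => [->|yz].
      by rewrite adj_sym pivot_adj_r // [adj _ _]adj_irr.
    rewrite pivot_adj_out //= /twin_adj /= adj_irr [adj z v]adj_sym vz.
    by rewrite addbb.
  by rewrite adj_irr.
apply: marked_equiv_trans (miso_equiv (miso_mdel_mdel t)) _.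
apply/marked_equiv_sym/miso_equiv.
apply: (@miso_mdel (mpivot v z) P _ _ inl) => //.
- by move=> x y [].
- by move=> x; rewrite !inE /= orbF.
- by case=> [x|[]]; rewrite !inE //; exists x.
Qed.

End Twins.

(** * Toggling the loop at a non-isolated vertex marked [c] or [u] *)

Definition toggle_at (G : mgraph) (v : G) : mgraph :=
  @MGraph G (@vmark_of G) (fun x => looped x (+) (x == v)) (free_loops G).

Section Toggle.
Variables (G : mgraph) (v z : G).
Hypothesis vz : adj v z.

Lemma toggle_c_looped :
  vmark_of v = Mc -> looped v -> marked_equiv G (toggle_at v).
Proof.
move=> mark_v loop_v; apply: marked_equiv_trans (delete_c mark_v loop_v vz) _.
apply: marked_equiv_sym.
(* The local complement at [v] of the toggled graph marks [v] with an unlooped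
   [cr]; [K] simplifies the [r] at [v] only. *)
pose K : mgraph := @MGraph (local_compl v)
  (fun x => if adj v x then nbr_change (vmark_of x) else vmark_of x)
  (@looped G) (free_loops G).
have K_v x : adj (v : K) x = adj v x.
  by rewrite /= /lc_adj adj_irr andbF addbF.
apply: (@marked_equiv_trans _ K).
  apply: marked_equiv_trans (@mlc_equiv (toggle_at v) v) _.
  apply: (@equiv_mod_r (@mlc (toggle_at v) v) K id) => //; first by exists id.
    by move=> x /=; case: eqVneq => // ->; rewrite adj_irr mark_v.
  move=> x /=; case: eqVneq => [->|_]; first by rewrite adj_irr mark_v loop_v.
  by rewrite addbF.
have vzK : adj (v : K) z by rewrite K_v.
have KmarkV : @vmark_of K v = Mc by rewrite /= adj_irr.
apply: marked_equiv_trans (@delete_c K v z KmarkV loop_v vzK) _.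
have z_v : z != v by apply: contraTneq vz => ->; rewrite adj_irr.
have zV : (z : @mpivot K v z) \notin [set v] by rewrite inE.
(* Away from [v], the operations leading from [G] to the new graph are local complements at [v],
   then [v], [z], [v] for the pivot, then [z]. The first two cancel, and what is left, [z], [v],
   [z], is the pivot on [vz] with its ends exchanged. The mark at [v] does not matter since [v] is
   deleted. *)
apply: marked_equiv_trans
  (@mlc_mdel (@mpivot K v z) [set v] (exist _ z zV)) _.
apply: miso_equiv.
pose P := @pivot K v z.
have P_z x : x != v -> x != z -> adj (z : P) x = adj v x.
  by move=> xv xz; rewrite pivot_adj_r // K_v.
have adjE (x y : G) : x != v -> y != v ->
    adj (x : pivot v z) y = @lc_adj P z x y.
  move=> xv yv.
  have aux u : u != v -> adj (z : pivot v z) u = @lc_adj P z z u.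
    move=> uv; rewrite /lc_adj adj_irr andbF addbF.
    case: (eqVneq u z) => [->|uz]; first by rewrite !adj_irr.
    by rewrite pivot_adj_r // P_z.
  case: (eqVneq x z) => [->|xz]; first exact: aux.
  case: (eqVneq y z) => [->|yz].
    by rewrite adj_sym [RHS]lc_adj_sym; apply: aux.
  rewrite /lc_adj !P_z // !pivot_adj_out // !K_v /= /lc_adj.
  rewrite ![z == _]eq_sym (negPf xz) (negPf yz) vz /=.
  case: (eqVneq x y) => [->|_] /=.
    by rewrite adj_irr; case: (adj v y); case: (adj z y).
  by case: (adj x y); case: (adj v x); case: (adj z x); case: (adj v y);
    case: (adj z y).
have markE (x : G) : x != v ->
    @vmark_of (mpivot v z) x = @vmark_of (@mlc (@mpivot K v z) z) x.
  move=> xv; have -> : @vmark_of (@mlc (@mpivot K v z) z) x =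
    if x == z then self_change (@vmark_of (@mpivot K v z) x) else
    if adj (z : P) x then nbr_change (@vmark_of (@mpivot K v z) x)
    else @vmark_of (@mpivot K v z) x by [].
  rewrite !mpivot_mark // (negPf xv); case: (eqVneq x z) => [->|xz].
    by rewrite /= vz nbr_changeK change_braid.
  by rewrite P_z //=; case: (adj v x); rewrite ?nbr_changeK.
apply: (@miso_mdel (@mlc (@mpivot K v z) z) (mpivot v z) _ _ id) => //.
- by move=> y _; exists y.
- by move=> x y; rewrite !inE; apply: adjE.
- by move=> x; rewrite !inE; apply: markE.
Qed.

End Toggle.

Lemma toggle_atK (G : mgraph) (v : G) :
  marked_equiv (@toggle_at (toggle_at v) v) G.
Proof.
case: G v => -[V a sa ia] m l n v; apply: id_equiv => // x /=.
by rewrite addbK.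
Qed.

Lemma toggle_c (G : mgraph) (v z : G) :
  adj v z -> vmark_of v = Mc -> marked_equiv G (toggle_at v).
Proof.
move=> vz mark_v; case loop_v : (looped v).
  exact: toggle_c_looped vz mark_v loop_v.
apply: marked_equiv_sym; apply: marked_equiv_trans (toggle_atK v).
by apply: (@toggle_c_looped (toggle_at v) v z) => //=; rewrite loop_v eqxx.
Qed.

(** A local complement at [z] turns the mark [u] of [v] into [cr], which simplifies to [c]. Both
    operations commute with toggling the loop at [v], so the case of [c] applies. *)
Lemma toggle_u (G : mgraph) (v z : G) :
  adj v z -> vmark_of v = Mu -> marked_equiv G (toggle_at v).
Proof.
move=> vz mark_v; have zv : adj z v by rewrite adj_sym.
have v_z : (v == z) = false.
  by apply: contraTF vz => /eqP->; rewrite adj_irr.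
have simp (H : mgraph) (x : H) : marked_equiv H (r_simplify (mlc x)).
  exact: marked_equiv_trans (mlc_equiv x) (r_simplify_equiv _).
apply: marked_equiv_trans (simp _ z) _.
apply: marked_equiv_trans _ (marked_equiv_sym (simp (toggle_at v) z)).
apply: (@marked_equiv_trans _ (@toggle_at (r_simplify (mlc z)) v)).
  apply: (@toggle_c (r_simplify (mlc z)) v z) => /=.
    by rewrite /lc_adj adj_irr !andbF addbF.
  by rewrite v_z zv mark_v.
by apply: id_equiv => // x /=; rewrite addbAC.
Qed.

(** * The two [Og2] moves *)

Lemma mark_liso G H : liso G H -> marked_equiv (mark G) (mark H).
Proof.
move=> [f [bij_f adj_f lab_f]]; apply: miso_equiv; split=> //; exists f.
by split=> // x /=; rewrite lab_f.
Qed.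

Lemma loop_of_opp b s :
  loop_of_label (b, opp_sign s) = ~~ loop_of_label (b, s).
Proof. by case: b; case: s. Qed.

Lemma has_r_mark l : has_r (mark_of_label l) = false.
Proof. by case: l => -[]. Qed.

Lemma drop_r_mark l : drop_r (mark_of_label l) = mark_of_label l.
Proof. by case: l => -[]. Qed.

Lemma id_bij (T : Type) : bijective (@id T). Proof. by exists id. Qed.

Definition unmark (G : mgraph) (v w : G) : mgraph :=
  @MGraph G (fun x => if (x == v) || (x == w) then Mnone else vmark_of x)
    (@looped G) (free_loops G).

(** This is the common last step of both [Og2] moves: Omega.2(a) requires [v] and [w] unmarked,
    while their original marks disappear with them. *)
Lemma unmarked_pair_equiv (G : mgraph) (v w : G) :
  looped w = ~~ looped v -> same_nbrs_outside v w ->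
  marked_equiv (unmark v w) (mdel [set v; w]).
Proof.
move=> loop_w vw.
apply: marked_equiv_trans (@omega2a_equiv (unmark v w) v w loop_w _ _ vw) _.
- by rewrite /unmarked /= eqxx.
- by rewrite /unmarked /= eqxx orbT.
apply: miso_equiv; apply: (@miso_mdel (unmark v w) G _ _ id) => //.
  by move=> x _; exists x.
by move=> x /=; rewrite !inE => /negPf->.
Qed.

(** Local complements at non-adjacent vertices with equal neighborhoods toggle the same pairs and
    change the same marks. Together they only turn the marks [u] of [v] and [w] into no mark. *)
Lemma og2_nonadj_equiv (G : lgraph) (v w : G) (a : sign) :
  v != w -> ~~ adj v w -> lab v = (false, a) -> lab w = (false, opp_sign a) ->
  same_nbrs_outside v w ->
  marked_equiv (mark G) (mark (ldel [set v; w])).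
Proof.
move=> v_w /negPf vw lab_v lab_w nbrs.
have wv : adj w v = false by rewrite adj_sym.
have loop_w : @looped (mark G) w = ~~ @looped (mark G) v.
  by rewrite /= lab_v lab_w loop_of_opp.
apply: marked_equiv_trans (unmarked_pair_equiv loop_w nbrs).
pose K := @mlc (@mlc (mark G) v) w.
apply: (@marked_equiv_trans _ K).
  exact: marked_equiv_trans (mlc_equiv _) (mlc_equiv _).
have markE x : @vmark_of (unmark (G := mark G) v w) x = @vmark_of K x.
  rewrite /= /lc_adj vw andbF /= !addbF.
  case: (eqVneq x v) => [->|xv] /=; first by rewrite (negPf v_w) wv lab_v.
  case: (eqVneq x w) => [->|xw] /=; first by rewrite vw lab_w.
  by rewrite nbrs //; case: (adj w x); rewrite ?nbr_changeK.
apply: (@equiv_mod_r K (unmark (G := mark G) v w) id) => //.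
- exact: id_bij.
- move=> x y; rewrite /= /lc_adj /= /lc_adj vw !andbF !addbF /=.
  case: (eqVneq x y) => [->|xy] /=; first by rewrite !addbF.
  case: (eqVneq x v) => [->|xv]; first by rewrite adj_irr wv !addbF.
  case: (eqVneq x w) => [->|xw]; first by rewrite adj_irr vw !addbF.
  case: (eqVneq y v) => [->|yv]; first by rewrite adj_irr wv !andbF !addbF.
  case: (eqVneq y w) => [->|yw]; first by rewrite adj_irr vw !andbF !addbF.
  by rewrite !nbrs // addbK.
- by move=> x; rewrite -markE.
- by move=> x; rewrite -markE.
Qed.

(** The pivot on [vw] exchanges two equal neighborhoods, and its determinant vanishes elsewhere, so
    adjacency is unchanged. The marks of [v] and [w] run through [c], [ur], [r], unmarked. *)
Lemma og2_adj_equiv (G : lgraph) (v w : G) (a : sign) :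
  adj v w -> lab v = (true, a) -> lab w = (true, opp_sign a) ->
  same_nbrs_outside v w ->
  marked_equiv (mark G) (mark (ldel [set v; w])).
Proof.
move=> vw lab_v lab_w nbrs.
have loop_w : @looped (mark G) w = ~~ @looped (mark G) v.
  by rewrite /= lab_v lab_w loop_of_opp.
apply: marked_equiv_trans (unmarked_pair_equiv loop_w nbrs).
apply: marked_equiv_trans (@mpivot_equiv (mark G) v w) _.
apply: (@equiv_mod_r (@mpivot (mark G) v w) (unmark (G := mark G) v w) id)
  => //.
- exact: id_bij.
- have aux u : adj (v : G) u = adj (v : pivot v w) u.
    case: (eqVneq u v) => [->|uv]; first by rewrite !adj_irr.
    case: (eqVneq u w) => [->|uw]; first by rewrite vw pivot_adj_lr.
    by rewrite pivot_adj_l // nbrs.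
  have aux' u : adj (w : G) u = adj (w : pivot v w) u.
    case: (eqVneq u v) => [->|uv]; first by rewrite adj_sym aux adj_sym.
    case: (eqVneq u w) => [->|uw]; first by rewrite !adj_irr.
    by rewrite pivot_adj_r // nbrs.
  have adjE (x y : G) : adj x y = adj (x : pivot v w) y.
    case: (eqVneq x v) => [->|xv]; first exact: aux.
    case: (eqVneq x w) => [->|xw]; first exact: aux'.
    case: (eqVneq y v) => [->|yv]; first by rewrite adj_sym aux adj_sym.
    case: (eqVneq y w) => [->|yw]; first by rewrite adj_sym aux' adj_sym.
    by rewrite pivot_adj_out // !nbrs // addbb addbF.
  by move=> x y; apply: adjE.
- move=> x; rewrite mpivot_mark //=.
  case: (eqVneq x v) => [->|xv] /=; first by rewrite lab_v.
  by case: (eqVneq x w) => [->|xw] //=; rewrite lab_w.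
- move=> x; rewrite mpivot_mark //=.
  case: (eqVneq x v) => [->|xv] /=; first by rewrite lab_v.
  by case: (eqVneq x w) => [->|xw] //=; rewrite lab_w.
Qed.

(** * The moves [Og4] and [Og4'] *)

Lemma og4_equiv (G : lgraph) (v w : G) (a b : sign) :
  adj v w -> lab v = (false, a) -> lab w = (false, b) ->
  marked_equiv (mark G) (mark (og4 v w a b)).
Proof.
move=> vw lab_v lab_w; have wv : adj w v by rewrite adj_sym.
have v_w : (v == w) = false.
  by apply: contraTF vw => /eqP->; rewrite adj_irr.
pose G' := @LGraph G [eta @lab G with v |-> (false, b), w |-> (false, a)].
apply: (@marked_equiv_trans _ (mark G')).
  (* Exchanging equal signs does nothing; exchanging opposite signs negates both, which amounts to
     toggling both loops. *)
  have [ab|ab] : a = b \/ b = opp_sign a by case: (a) (b) => -[]; auto.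
    apply: mark_liso; exists id; split=> //; first exact: id_bij.
    move=> x /=; case: eqVneq => [->|_]; first by rewrite lab_v ab.
    by case: eqVneq => [->|_] //; rewrite lab_w ab.
  have mark_v : @vmark_of (mark G) v = Mu by rewrite /= lab_v.
  have mark_w : @vmark_of (mark G) w = Mu by rewrite /= lab_w.
  apply: marked_equiv_trans (@toggle_u (mark G) v w vw mark_v) _.
  apply: marked_equiv_trans
    (@toggle_u (toggle_at (G := mark G) v) w v wv mark_w) _.
  apply: (@equiv_mod_r (@toggle_at (@toggle_at (mark G) v) w) (mark G') id)
    => //; first exact: id_bij.
    move=> x /=; case: eqVneq => [->|_]; first by rewrite lab_v.
    by case: eqVneq => [->|_] //; rewrite lab_w.
  move=> x /=; rewrite !has_r_mark !addbF.
  case: (eqVneq x v) => [->|_] /=.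
    by rewrite lab_v v_w ab; case: (a).
  case: (eqVneq x w) => [->|_] /=; last by rewrite !addbF.
  by rewrite lab_w ab; case: (a).
(* The marks of [v] and [w] run through [u], [cr], [c], [ur]; dropping the [r] restores [u] and
   toggles the loop, which negates the sign. *)
apply: marked_equiv_trans (@mpivot_equiv (mark G') v w) _.
apply: (@equiv_mod_r (@mpivot (mark G') v w) (mark (og4 v w a b)) id) => //.
- exact: id_bij.
- move=> x; rewrite (@mpivot_mark (mark G') v w vw x) /=.
  case: (eqVneq x v) => [->|xv] //=.
  by case: (eqVneq x w) => [_|_].
- move=> x; rewrite (@mpivot_mark (mark G') v w vw x) /=.
  case: (eqVneq x v) => [_|_] //=; first by case: (b).
  case: (eqVneq x w) => [_|_] //=; by case: (a).
Qed.

(** At [v] the mark [c] becomes [cr], that is, [c] with the loop toggled, so the sign is negated. At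
    a neighbor [c] and [u] become [ur] and [cr]; as [loop_of_label] uses opposite loop conventions
    for [c] and [u], the toggled loop encodes the same sign. *)
Lemma og4'_equiv (G : lgraph) (v : G) (a : sign) :
  lab v = (true, a) -> marked_equiv (mark G) (mark (og4' v a)).
Proof.
move=> lab_v; apply: marked_equiv_trans (@mlc_equiv (mark G) v) _.
apply: (@equiv_mod_r (@mlc (mark G) v) (mark (og4' v a)) id) => //.
- exact: id_bij.
- move=> x /=; case: eqVneq => [->|_]; first by rewrite lab_v.
  by case: (adj v x); rewrite ?drop_r_mark //; case: (lab x) => -[].
- move=> x /=; case: eqVneq => [->|_]; first by rewrite lab_v; case: (a).
  by case: (adj v x); case: (lab x) => -[] [].
Qed.

(** * The move [Og3] *)

Lemma lc_adj_nonadj (G : sgraph) (v w a b : G) : adj v w = false ->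
  lc_adj (G := local_compl v) w a b
  = adj a b (+) ((a != b) && ((adj v a && adj v b) (+) (adj w a && adj w b))).
Proof.
move=> vw; rewrite /lc_adj /= /lc_adj vw !andbF !addbF.
by case: (a == b); rewrite /= ?addbF ?addbA.
Qed.

Section Og3.
Variables (G : lgraph) (v w x : G).
Hypotheses (vwx : uniq [:: v; w; x]) (lab_v : lab v = (false, Minus))
  (lab_w : lab w = (false, Minus)) (lab_x : lab x = (false, Minus))
  (nbr_x : forall y, adj x y = (y == v) || (y == w)) (vw : ~~ adj v w).

(** [M1] joins [v] to [w], so that a pivot on [vw] is possible; [N2] contains the unmarked triangle
    [x], [v], [w], which is opened in [N3]; the local complements in [N4] bring back the marks [u]
    and the adjacencies among the other vertices. *)
Let M : mgraph := mark G.
Let M1 : mgraph := @mlc M x.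
Let N2 : mgraph := r_simplify (@mpivot M1 v w).
Let N3 : mgraph := @remove_triangle N2 x v w.
Let N4 : mgraph := @mlc (@mlc (@mlc N3 x) v) w.

Let other (y : G) : bool := [&& y != v, y != w & y != x].

Let neqs : [/\ (v == w) = false, (v == x) = false & (w == x) = false].
Proof.
by have := vwx; rewrite /= !inE negb_or andbT
  => /andP[/andP[/negPf-> /negPf->] /negPf->].
Qed.
Let v_w : (v == w) = false. Proof. by case: neqs. Qed.
Let w_v : (w == v) = false. Proof. by rewrite eq_sym. Qed.
Let v_x : (v == x) = false. Proof. by case: neqs. Qed.
Let x_v : (x == v) = false. Proof. by rewrite eq_sym. Qed.
Let w_x : (w == x) = false. Proof. by case: neqs. Qed.
Let x_w : (x == w) = false. Proof. by rewrite eq_sym. Qed.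

Let adj_wv : adj w v = false. Proof. by rewrite adj_sym; apply: negPf. Qed.
Let adj_vx : adj v x. Proof. by rewrite adj_sym nbr_x eqxx. Qed.
Let adj_wx : adj w x. Proof. by rewrite adj_sym nbr_x eqxx orbT. Qed.

Let vw1 : adj (v : M1) w.
Proof. by rewrite /= /lc_adj (negPf vw) v_w !nbr_x !eqxx orbT. Qed.

Let adj1_v y : y != w -> adj (v : M1) y = adj v y.
Proof.
move=> yw; rewrite /= /lc_adj !nbr_x (negPf yw) orbF.
by rewrite [v == y]eq_sym; case: (y == v); rewrite ?andbF ?addbF.
Qed.

Let adj1_w y : y != v -> adj (w : M1) y = adj w y.
Proof.
move=> yv; rewrite /= /lc_adj !nbr_x (negPf yv) /=.
by rewrite [w == y]eq_sym; case: (y == w); rewrite ?andbF ?addbF.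
Qed.

Let adj1_out (y z : G) : z != v -> z != w -> adj (y : M1) z = adj y z.
Proof.
by move=> /negPf zv /negPf zw; rewrite /= /lc_adj !nbr_x zv zw !andbF addbF.
Qed.

Let adj2_vw : adj (v : N2) w. Proof. exact: pivot_adj_lr vw1. Qed.

Let adj2_v y : y != v -> y != w -> adj (v : N2) y = adj w y.
Proof. by move=> yv yw; rewrite -adj1_w //; apply: pivot_adj_l. Qed.

Let adj2_w y : y != v -> y != w -> adj (w : N2) y = adj v y.
Proof. by move=> yv yw; rewrite -adj1_v //; apply: pivot_adj_r. Qed.

Let adj2_out (y z : G) : y != v -> y != w -> z != v -> z != w ->
  adj (y : N2) z = adj y z (+) ((adj v y && adj w z) (+) (adj w y && adj v z)).
Proof.
move=> yv yw zv zw.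
rewrite -[LHS]/(adj (y : @pivot M1 v w) z) pivot_adj_out //.
by rewrite !adj1_v // !adj1_w // adj1_out.
Qed.

Let adj2_x y : y != v -> y != w -> adj (x : N2) y = adj v y (+) adj w y.
Proof.
move=> yv yw; rewrite adj2_out ?x_v ?x_w // nbr_x (negPf yv) (negPf yw).
by rewrite adj_vx adj_wx addbC addbF [RHS]addbC.
Qed.

(** The local complement at [x] unmarks [x] and turns [u] into [cr] at [v] and [w]. The pivot turns
    [cr] into [r], so simplification unmarks [v] and [w] and toggles their loops, as recorded in
    [loop2]. *)
Let mark2 (y : G) : @vmark_of N2 y =
  if [|| y == v, y == w | y == x] then Mnone else mark_of_label (lab y).
Proof.
rewrite -[LHS]/(drop_r (@vmark_of (@mpivot M1 v w) y)) mpivot_mark //=.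
rewrite nbr_x; case: (eqVneq y v) => [->|yv] /=; first by rewrite v_x lab_v.
case: (eqVneq y w) => [->|yw] /=; first by rewrite w_x lab_w.
by case: (eqVneq y x) => [->|yx]; rewrite ?lab_x ?drop_r_mark.
Qed.

Let loop2 (y : G) : @looped N2 y =
  ((y == v) || (y == w)) (+) loop_of_label (lab y).
Proof.
rewrite -[LHS]/(loop_of_label (lab y) (+)
                 has_r (@vmark_of (@mpivot M1 v w) y)) mpivot_mark //=.
rewrite nbr_x; case: (eqVneq y v) => [->|yv] /=; first by rewrite v_x lab_v.
case: (eqVneq y w) => [->|yw] /=; first by rewrite w_x lab_w.
by case: (eqVneq y x) => [->|yx]; rewrite ?lab_x ?has_r_mark ?addbF.
Qed.

Let adj2_xv : adj (x : N2) v.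
Proof. by rewrite adj_sym adj2_v ?x_v ?x_w. Qed.
Let adj2_xw : adj (x : N2) w.
Proof. by rewrite adj_sym adj2_w ?x_v ?x_w. Qed.

(** The mirror image is used because [x] is unlooped while [v] and [w] are looped. Adjacency to [x]
    is the sum mod 2 of adjacency to [v] and to [w], so an outside vertex meets the triangle in zero
    or two vertices. *)
Let N2_N3 : marked_equiv N2 N3.
Proof.
apply/omega_equiv/Or33/Omega3_mirror/Omega3_basic.
exists x, v, w; split.
- by split; apply: etrans (mark2 _) _; rewrite eqxx ?orbT.
- by split; [exact: adj2_xv | exact: adj2_xw | exact: adj2_vw].
- split; first by rewrite -[looped _]/(~~ @looped N2 x) loop2 x_v x_w lab_x.
    by rewrite -[looped _]/(~~ @looped N2 v) loop2 eqxx lab_v.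
  by rewrite -[looped _]/(~~ @looped N2 w) loop2 eqxx orbT lab_w.
- move=> y; rewrite !inE !negb_or -andbA => /and3P[yx yv yw].
  have yE (u : G) : @adj (toggle_loops N2) y u = @adj N2 u y by apply: adj_sym.
  rewrite !yE adj2_x // adj2_v // adj2_w //.
  by case: (adj v y); case: (adj w y).
- exact: miso_refl.
Qed.

Let adj3E (y z : G) : adj (y : N3) z =
  @adj N2 y z && ~~ (~~ other y && ~~ other z).
Proof.
rewrite /= /remove_edges_adj !inE /other !negb_and !negbK.
by case: (y == v); case: (y == w); case: (y == x);
  case: (z == v); case: (z == w); case: (z == x).
Qed.

Let other_v : other v = false. Proof. by rewrite /other eqxx. Qed.
Let other_w : other w = false. Proof. by rewrite /other eqxx andbF. Qed.
Let other_x : other x = false. Proof. by rewrite /other eqxx !andbF. Qed.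

Let adj3_in (y z : G) : ~~ other y -> ~~ other z -> adj (y : N3) z = false.
Proof. by move=> yS zS; rewrite adj3E yS zS andbF. Qed.

Let adj3_v y : other y -> adj (v : N3) y = adj w y.
Proof.
by move=> oy; rewrite adj3E oy andbF andbT; case/and3P: oy => *; apply: adj2_v.
Qed.

Let adj3_w y : other y -> adj (w : N3) y = adj v y.
Proof.
by move=> oy; rewrite adj3E oy andbF andbT; case/and3P: oy => *; apply: adj2_w.
Qed.

Let adj3_x y : other y -> adj (x : N3) y = adj v y (+) adj w y.
Proof.
by move=> oy; rewrite adj3E oy andbF andbT; case/and3P: oy => *; apply: adj2_x.
Qed.

Let adj3_out (y z : G) : other y -> other z -> adj (y : N3) z =
  adj y z (+) ((adj v y && adj w z) (+) (adj w y && adj v z)).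
Proof.
move=> oy oz; rewrite adj3E oy andbT.
by case/and3P: oy => *; case/and3P: oz => *; apply: adj2_out.
Qed.

Let XN3 : mgraph := @mlc N3 x.
Let VXN3 : mgraph := @mlc XN3 v.

Let adjX (u y : G) : ~~ other u -> adj (u : XN3) y = @adj N3 u y.
Proof.
move=> ou; rewrite -[LHS]/(@lc_adj N3 x u y) /lc_adj (@adj3_in x u) //.
  by rewrite andbF addbF.
by rewrite other_x.
Qed.

Let adjX_v (y : G) : adj (v : XN3) y = @adj N3 v y.
Proof. by rewrite adjX ?other_v. Qed.

Let adjX_w (y : G) : adj (w : XN3) y = @adj N3 w y.
Proof. by rewrite adjX ?other_w. Qed.

Let adjVX_w (y : G) : adj (w : VXN3) y = @adj N3 w y.
Proof.
rewrite -[LHS]/(@lc_adj XN3 v w y) /lc_adj !adjX_v adjX_w.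
by rewrite (@adj3_in v w) ?other_v ?other_w // andbF addbF.
Qed.

(** In [N3] the vertices [x], [v], [w] are pairwise non-adjacent, so each keeps its neighborhood
    until its own local complement and the three corrections add up. *)
Let adj4E (y z : G) : adj (y : N4) z = @adj N3 y z (+) ((y != z) &&
  ((@adj N3 x y && @adj N3 x z) (+) ((@adj N3 v y && @adj N3 v z)
    (+) (@adj N3 w y && @adj N3 w z)))).
Proof.
rewrite -[LHS]/(@lc_adj (@local_compl XN3 v) w y z).
rewrite lc_adj_nonadj; last by rewrite adjX_v adj3_in ?other_v ?other_w.
rewrite !adjX_v !adjX_w -[@adj XN3 y z]/(@lc_adj N3 x y z) /lc_adj -addbA.
by case: (y == z).
Qed.

(** Another vertex is adjacent in [N3] to none or two of [x], [v], [w], so its neighbor changes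
    cancel. *)
Let mark4E (y : G) : @vmark_of N4 y =
  if other y then @vmark_of N3 y else self_change (@vmark_of N3 y).
Proof.
have mlcE (H : mgraph) (u t : H) : @vmark_of (mlc u) t =
  if t == u then self_change (vmark_of t) else
  if adj u t then nbr_change (vmark_of t) else vmark_of t by [].
rewrite (mlcE VXN3) (mlcE XN3) (mlcE N3) adjVX_w adjX_v.
case: (eqVneq y v) => [->|yv].
  by rewrite v_w v_x other_v !adj3_in ?other_v ?other_w ?other_x.
case: (eqVneq y w) => [->|yw].
  by rewrite w_x other_w !adj3_in ?other_v ?other_w ?other_x.
case: (eqVneq y x) => [->|yx].
  by rewrite other_x !adj3_in ?other_v ?other_w ?other_x.
have oy : other y by rewrite /other yv yw.
rewrite oy adj3_v // adj3_w // adj3_x //.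
by case: (adj v y); case: (adj w y); rewrite /= ?nbr_changeK.
Qed.

(* The pivot exchanged the neighborhoods of [v] and [w]. *)
Let swap (y : G) : G := if y == v then w else if y == w then v else y.

Let swapK : involutive swap.
Proof.
move=> y; rewrite /swap.
case: (eqVneq y v) => [->|yv]; first by rewrite eqxx w_v.
case: (eqVneq y w) => [->|yw]; first by rewrite eqxx.
by rewrite (negPf yv) (negPf yw).
Qed.

Lemma og3_equiv : marked_equiv (mark G) (mark (og3 v w x)).
Proof.
apply: (@marked_equiv_trans _ N4).
  apply: marked_equiv_trans (@mlc_equiv M x) _.
  apply: marked_equiv_trans (@mpivot_equiv M1 v w) _.
  apply: marked_equiv_trans (@r_simplify_equiv (@mpivot M1 v w)) _.
  apply: marked_equiv_trans N2_N3 _.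
  apply: marked_equiv_trans (@mlc_equiv N3 x) _.
  apply: marked_equiv_trans (@mlc_equiv (@mlc N3 x) v) _.
  exact: mlc_equiv.
apply/marked_equiv_sym.
have swap_v : swap v = w by rewrite /swap eqxx.
have swap_w : swap w = v by rewrite /swap w_v eqxx.
have swap_id y : y != v -> y != w -> swap y = y.
  by rewrite /swap => /negPf-> /negPf->.
have inS (u : G) : [\/ u = v, u = w, u = x | other u].
  rewrite /other; case: (eqVneq u v) => [->|_]; first by constructor 1.
  case: (eqVneq u w) => [->|_]; first by constructor 2.
  by case: (eqVneq u x) => [->|_]; [constructor 3 | constructor 4].
have oE u : other u -> [/\ swap u = u, (u == v) = false, (u == w) = false
    & (u == x) = false].
  case/and3P=> uv uw ux; split;
    by rewrite ?swap_id ?(negPf uv) ?(negPf uw) ?(negPf ux).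
have in3 : (@adj N3 v v = false) * (@adj N3 v w = false)
  * (@adj N3 v x = false) * (@adj N3 w v = false) * (@adj N3 w w = false)
  * (@adj N3 w x = false) * (@adj N3 x v = false) * (@adj N3 x w = false)
  * (@adj N3 x x = false).
  by do !split; rewrite adj3_in ?other_v ?other_w ?other_x.
have swap_x : swap x = x by rewrite swap_id ?x_v ?x_w.
have adjE (y z : G) : adj (swap y : N4) (swap z) = og3_adj v w x y z.
  rewrite adj4E /og3_adj.
  case: (inS y) => [->|->|->|oy]; case: (inS z) => [->|->|->|oz];
  rewrite ?swap_v ?swap_w ?swap_x.
  all: try by rewrite !adj3_in ?other_v ?other_w ?other_x // ?andbF ?eqxx ?v_x
    ?w_x ?x_v ?x_w ?adj_irr ?(negPf vw) ?adj_wv ?adj_vx ?adj_wx.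
  all: try have [-> zv zw zx] := oE _ oz.
  all: try have [-> yv yw yx] := oE _ oy.
  (* Seven goals remain: three with only [z] outside the triple, three with only [y] outside it, and
     one with both outside. *)
  1-3: by rewrite !in3 ?(adj3_v oz) ?(adj3_w oz) ?(adj3_x oz) ?andbF ?addbF
    ?v_x ?w_x ?zx ?eqxx ?orbF.
  1-3: rewrite !(@adj_sym N3 y) !in3 ?(adj3_v oy) ?(adj3_w oy) ?(adj3_x oy)
    ?andbF ?addbF ?v_x ?w_x ?yx ?eqxx ?orbF //=.
  1-2: exact: adj_sym.
  (* With [a], [b] the adjacencies of [y] to [v], [w] and [c], [d] those of [z], the corrections sum
     to [(a+b)(c+d) + bd + ac = ad + bc], the determinant introduced by the pivot. *)
  rewrite adj3_out // !adj3_v // !adj3_w // !adj3_x // yx zx /=.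
  case: (eqVneq y z) => [->|_] /=.
    by rewrite adj_irr; case: (adj v z); case: (adj w z).
  by case: (adj y z); case: (adj v y); case: (adj w y); case: (adj v z);
    case: (adj w z).
have markE (y : G) : @vmark_of N4 (swap y) = @vmark_of (mark (og3 v w x)) y.
  rewrite mark4E -[@vmark_of N3 _]/(@vmark_of N2 _) mark2 /=.
  case: (inS y) => [->|->|->|oy]; rewrite ?swap_v ?swap_w ?swap_x.
  - by rewrite other_w !eqxx orbT.
  - by rewrite other_v !eqxx w_v.
  - by rewrite other_x !eqxx !orbT x_v x_w lab_x.
  - by have [-> -> -> ->] := oE _ oy; rewrite oy.
have loopE (y : G) : @looped N4 (swap y) = @looped (mark (og3 v w x)) y.
  rewrite -[LHS]/(@looped N2 (swap y)) loop2 /=.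
  case: (inS y) => [->|->|->|oy]; rewrite ?swap_v ?swap_w ?swap_x.
  - by rewrite !eqxx orbT lab_w.
  - by rewrite !eqxx w_v lab_v.
  - by rewrite x_v x_w.
  - by have [-> -> -> _] := oE _ oy.
apply: (@equiv_mod_r (mark (og3 v w x)) N4 swap) => //.
- by exists swap; apply: swapK.
- by move=> y; rewrite markE.
- by move=> y; rewrite markE loopE.
Qed.

End Og3.

(** * Induction over the generated equivalence *)

Theorem theorem28 (G H : lgraph) (GH : same_graph_link G H) :
  marked_equiv (mark G) (mark H).
Proof.
elim: GH => {G H} [G H|G|G H _|G K H _ GK _ KH].
- case=> [GH|v iso_v lab_v GH|v w a v_w vw lab_v lab_w nbrs GH
    |v w a vw lab_v lab_w nbrs GH|v w x uniq_vwx lab_v lab_w lab_x nbr_x vw GH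
    |v w a b vw lab_v lab_w GH|v a lab_v GH].
  + exact: mark_liso.
  + apply: marked_equiv_trans (mark_liso GH).
    apply: (@omega1_equiv (mark G)) => //; right.
    by rewrite /= /mark_of_label lab_v.
  + exact: marked_equiv_trans (og2_nonadj_equiv v_w vw lab_v lab_w nbrs)
      (mark_liso GH).
  + exact: marked_equiv_trans (og2_adj_equiv vw lab_v lab_w nbrs)
      (mark_liso GH).
  + exact: marked_equiv_trans (og3_equiv uniq_vwx lab_v lab_w lab_x nbr_x vw)
      (mark_liso GH).
  + exact: marked_equiv_trans (og4_equiv vw lab_v lab_w) (mark_liso GH).
  + exact: marked_equiv_trans (og4'_equiv lab_v) (mark_liso GH).
- exact: rst_refl.
- exact: marked_equiv_sym.
- exact: marked_equiv_trans GK KH.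
Qed.
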